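(* Let $N\ge 1$, $M,D>0$, and let $W\in\mathbb{R}^{N\times N}$ be a lower triangular weight matrix defining a nondegenerate fixed-step subgradient method. Then there exist a nonnegative vector $a=(a_0,\dots,a_N)\in\mathbb{R}^{N+1}$ with $\sum_{i=0}^N a_i=1$ and a constant $\sigma>0$ such that the following holds for every $d\geq 1$, every $M$-Lipschitz convex function $f:\mathbb{R}^d\to\mathbb{R}$, every minimizer $x_\star$ of $f$, every $x_0\in\mathbb{R}^d$ with $\|x_0-x_\star\|\le D$, and all iterates and subgradients satisfying $x_n=x_0-\sum_{i=0}^{n-1}W_{n-1,i}\,g_i$ for $n=1,\dots,N$ and $g_i\in\partial f(x_i)$ for $i=0,\dots,N$. Write $f_N=f(x_N)$, $f_\star=f(x_\star)$, $$\alpha(x)=\sum_{i=0}^N a_i\big(f(x_i)+\langle g_i,x-x_i\rangle\big),\qquad z_{N+1}=x_0-\frac{1}{2\sigma}\nabla\alpha .$$ Then $\alpha\in A_f\subset A_f^\star$, $$f_N-f_\star\ \le\ f_N-\alpha(x_\star)+\sigma\|z_{N+1}-x_\star\|^2\ \le\ \mathtt{PEP}_M(W),$$ and $$f_N-f_\star\ \le\ f_N-\min_{\|x-x_0\|\le D}\alpha(x)\ \le\ \mathtt{PEP}_M(W).$$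
   Context: Rows and columns of $W$ are indexed by $0,\dots,N-1$. $\|\cdot\|$, $\langle\cdot,\cdot\rangle$ are Euclidean. $A_f$ is the set of affine functions $\alpha$ on $\mathbb{R}^d$ with $\alpha\le f$ everywhere; $A_f^\star$ is the set of affine functions $\alpha$ with $\alpha(x_\star)\le f(x_\star)$. $\nabla\alpha$ is the constant gradient of an affine function. The performance estimation problem (PEP). Let $\mathcal{I}=\{\star,0,\dots,N\}$. The PEP is the semidefinite program in the variables $(f_i)_{i\in\mathcal{I}}\in\mathbb{R}^{N+2}$ and a symmetric positive semidefinite $(N+2)\times(N+2)$ matrix $G$, where $G$ represents the Gram matrix $G=P^\top P$ of $P=[x_0-x_\star,\,g_0,\dots,g_N]$. After substituting $g_\star=0$ and $x_n=x_0-\sum_{i=0}^{n-1}W_{n-1,i}g_i$ ($n=1,\dots,N$), every difference $x_i-x_j$ ($i,j\in\mathcal{I}$) and every $g_i$ is a fixed linear combination of the columns of $P$, so the following are affine functions of $((f_i)_{i\in\mathcal{I}},G)$: $$\mathcal{C}_{i,j}=f_i-f_j-\langle g_j,x_i-x_j\rangle,\qquad \mathcal{M}_i=M^2-\|g_i\|^2,\qquad \mathcal{D}=D^2-\|x_0-x_\star\|^2 .$$ $\mathtt{PEP}_M(W)$ is the optimal value of: maximize $f_N-f_\star$ subject to $\mathcal{C}_{i,j}\ge0$ for all $i,j\in\mathcal{I}$, $\mathcal{M}_i\ge 0$ for all $i\in\mathcal{I}$, $\mathcal{D}\ge 0$, $G\succeq 0$. (When $d\ge N+2$ this equals the worst case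 of $f(x_N)-f(x_\star)$ over all $M$-Lipschitz convex $f$ on $\mathbb{R}^d$ with a minimizer satisfying $\|x_0-x_\star\|\le D$.) The dual semidefinite program is: minimize $r$ over $r\in\mathbb{R}$, $\lambda_{i,j},\gamma_i,\sigma\ge0$ ($i,j\in\mathcal{I}$) and $Z\succeq0$ such that $$r-(f_N-f_\star)=\sum_{i,j\in\mathcal{I}}\lambda_{i,j}\mathcal{C}_{i,j}+\sum_{i\in\mathcal{I}}\gamma_i\mathcal{M}_i+\sigma\mathcal{D}+\langle Z,G\rangle$$ holds identically as affine functions of the free variables $((f_i)_{i\in\mathcal{I}},G)$. The method defined by $W$ is nondegenerate if (i) strong duality holds between these two semidefinite programs, with both primal and dual optima attained, and (ii) for each $i=0,\dots,N$ there is an optimal solution of the primal PEP with $f_i>f_\star$. *)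

(* Defs.v *)
From HB Require Import structures.
From mathcomp Require Import all_boot all_order all_algebra.
From mathcomp Require Import all_classical all_reals all_analysis.
Set Implicit Arguments.
Unset Strict Implicit.
Unset Printing Implicit Defensive.
Import Order.TTheory GRing.Theory Num.Theory.
Import numFieldNormedType.Exports.
Local Open Scope classical_set_scope.
Local Open Scope ring_scope.

(* The norm that 'rV[R]_d carries in the library is the sup norm, so the
   Euclidean inner product and norm are defined here. *)
Definition dotp (R : realType) (d : nat) (u v : 'rV[R]_d) : R :=
  \sum_(i < d) u 0 i * v 0 i.

Definition enorm (R : realType) (d : nat) (u : 'rV[R]_d) : R :=
  Num.sqrt (dotp u u).

Definition lipschitz_euclid (R : realType) (d : nat) (M : R)
    (f : 'rV[R]_d -> R) : Prop :=
  forall x y, `|f x - f y| <= M * enorm (x - y).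

Definition minimizer (R : realType) (d : nat) (f : 'rV[R]_d -> R)
    (xs : 'rV[R]_d) : Prop :=
  forall y, f xs <= f y.

Definition subdifferential (R : realType) (d : nat) (f : 'rV[R]_d -> R)
    (x : 'rV[R]_d) : set 'rV[R]_d :=
  [set g | forall y, f x + dotp g (y - x) <= f y].

Definition affine (R : realType) (d : nat) (h : 'rV[R]_d -> R) : Prop :=
  exists (v : 'rV[R]_d) (c : R), forall x, h x = dotp v x + c.

Definition affine_minorants (R : realType) (d : nat) (f : 'rV[R]_d -> R) :
    set ('rV[R]_d -> R) :=
  [set h | affine h /\ forall x, h x <= f x].

Definition affine_minorants_at (R : realType) (d : nat) (f : 'rV[R]_d -> R)
    (xs : 'rV[R]_d) : set ('rV[R]_d -> R) :=
  [set h | affine h /\ h xs <= f xs].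

Definition grad (R : realType) (d : nat) (h : 'rV[R]_d -> R) (x : 'rV[R]_d) :
    'rV[R]_d :=
  \row_(j < d) 'D_(delta_mx 0 j) (h : 'rV[R]_d -> R^o) x.

Definition is_min_on (R : realType) (T : Type) (A : set T) (h : T -> R)
    (m : R) : Prop :=
  (exists2 y, A y & h y = m) /\ (forall y, A y -> m <= h y).

Definition psd (R : realType) (n : nat) (A : 'M[R]_n) : Prop :=
  A^T = A /\ forall u : 'rV[R]_n, 0 <= (u *m A *m u^T) 0 0.

(* The index set {star, 0, ..., N}; None is the star. *)
Definition pep_index (N : nat) : Type := option 'I_N.+1.

(* Coordinates of g_i and of x_i - x_star with respect to the columns of
   P = [x_0 - x_star, g_0, ..., g_N]: coordinate ord0 belongs to x_0 - x_star
   and coordinate lift ord0 k belongs to g_k. *)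
Definition gcoord (R : realType) (N : nat) (i : pep_index N) : 'rV[R]_N.+2 :=
  if i is Some k then delta_mx 0 (lift ord0 k) else 0.

(* Here unlift ord0 k = Some n means that k = n + 1, so that row n = k - 1 of
   W is used. *)
Definition xcoord (R : realType) (N : nat) (W : 'M[R]_N) (i : pep_index N) :
    'rV[R]_N.+2 :=
  if i is Some k then
    delta_mx 0 ord0 -
    (if unlift ord0 k is Some n then
       \sum_(j < N | (j <= n)%N)
          W n j *: gcoord R (Some (widen_ord (leqnSn N) j))
     else 0)
  else 0.

(* <P u, P v> when G = P^T P. *)
Definition gram_dot (R : realType) (n : nat) (G : 'M[R]_n) (u v : 'rV[R]_n) :
    R :=
  (u *m G *m v^T) 0 0.

Definition pep_C (R : realType) (N : nat) (W : 'M[R]_N)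
    (F : pep_index N -> R) (G : 'M[R]_N.+2) (i j : pep_index N) : R :=
  F i - F j - gram_dot G (gcoord R j) (xcoord W i - xcoord W j).

Definition pep_M (R : realType) (N : nat) (M : R) (G : 'M[R]_N.+2)
    (i : pep_index N) : R :=
  M ^+ 2 - gram_dot G (gcoord R i) (gcoord R i).

Definition pep_D (R : realType) (N : nat) (D : R) (G : 'M[R]_N.+2) : R :=
  D ^+ 2 - gram_dot G (delta_mx 0 ord0) (delta_mx 0 ord0).

Definition pep_obj (R : realType) (N : nat) (F : pep_index N -> R) : R :=
  F (Some ord_max) - F None.

Definition pep_feasible (R : realType) (N : nat) (M D : R) (W : 'M[R]_N)
    (F : pep_index N -> R) (G : 'M[R]_N.+2) : Prop :=
  [/\ forall i j, 0 <= pep_C W F G i j,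
      forall i : pep_index N, 0 <= pep_M M G i,
      0 <= pep_D D G
    & psd G].

Definition pep_value (R : realType) (N : nat) (M D : R) (W : 'M[R]_N) : \bar R :=
  ereal_sup [set v | exists (F : pep_index N -> R) (G : 'M[R]_N.+2),
    pep_feasible M D W F G /\ v = (pep_obj F)%:E].

Definition pep_optimal (R : realType) (N : nat) (M D : R) (W : 'M[R]_N)
    (F : pep_index N -> R) (G : 'M[R]_N.+2) : Prop :=
  pep_feasible M D W F G /\
  forall F' G', pep_feasible M D W F' G' -> pep_obj F' <= pep_obj F.

(* The identity is required for all symmetric G, not only for G psd. *)
Definition dual_feasible (R : realType) (N : nat) (M D : R) (W : 'M[R]_N)
    (r : R) (lam : pep_index N -> pep_index N -> R) (gam : pep_index N -> R)
    (sigma : R) (Z : 'M[R]_N.+2) : Prop :=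
  [/\ forall i j, 0 <= lam i j,
      forall i, 0 <= gam i,
      0 <= sigma,
      psd Z
    & forall (F : pep_index N -> R) (G : 'M[R]_N.+2), G^T = G ->
        r - pep_obj F =
          \sum_(i : option 'I_N.+1) \sum_(j : option 'I_N.+1)
             lam i j * pep_C W F G i j
          + \sum_(i : option 'I_N.+1) gam i * pep_M M G i
          + sigma * pep_D D G
          + \tr (Z^T *m G)].

Definition dual_objectives (R : realType) (N : nat) (M D : R) (W : 'M[R]_N) :
    set R :=
  [set r | exists lam gam sigma Z, dual_feasible M D W r lam gam sigma Z].

Definition dual_value (R : realType) (N : nat) (M D : R) (W : 'M[R]_N) : \bar R :=
  ereal_inf [set r%:E | r in dual_objectives M D W].

Definition nondegenerate_method (R : realType) (N : nat) (M D : R) (W : 'M[R]_N) :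
    Prop :=
  [/\ pep_value M D W = dual_value M D W,
      exists F G, pep_optimal M D W F G,
      exists r, is_min_on (dual_objectives M D W) id r
    & forall i : 'I_N.+1, exists F G,
        pep_optimal M D W F G /\ F None < F (Some i)].

(* Main.v *)
(* Take a dual optimum (r, lam, gam, sigma, Z). Complementary slackness at the
   primal optima with f_i > f_star gives lam_(i,star) = 0, and comparing the
   coefficients of f_star then gives sum_k lam_(star,k) = 1: these are the
   weights a. With lam_(i,star) = 0, the point x_star enters the dual identity
   only through alpha(x_star) and |x0 - x_star|^2, so the identity may be
   evaluated at the Gram matrix of [x0 - y, g_0, ..., g_N] for an arbitrary
   point y; dropping nonnegative terms yields
     f_N - alpha(y) + sigma (D^2 - |x0 - y|^2) <= r.
   The choice y = z_(N+1) gives the first bound, and y = argmin of alpha on the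
   ball gives the second one. In dimension one with all g_k = 1, letting y tend
   to -oo excludes sigma = 0. *)
Require Import Defs.
From HB Require Import structures.
From mathcomp Require Import all_boot all_order all_algebra.
From mathcomp Require Import all_classical all_reals all_analysis.
From mathcomp Require Import ring lra.
Set Implicit Arguments.
Unset Strict Implicit.
Unset Printing Implicit Defensive.
Import Order.TTheory GRing.Theory Num.Theory.
Import numFieldNormedType.Exports.
Local Open Scope classical_set_scope.
Local Open Scope ring_scope.

(** * Sums over optional indices and the Euclidean inner product *)

Lemma sum_option (V : nmodType) (I : finType) (F : option I -> V) :
  \sum_(i : option I) F i = F None + \sum_(i : I) F (Some i).
Proof.
rewrite (bigD1 None) //=; congr (_ + _).
by rewrite (reindex_omap Some id) //=; [apply: eq_bigl => i; rewrite eqxx | case].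
Qed.

Lemma dotpE (R : realType) (d : nat) (u v : 'rV[R]_d) :
  dotp u v = (u *m v^T) 0 0.
Proof. by rewrite mxE; apply: eq_bigr => i _; rewrite mxE. Qed.

Lemma dotpC (R : realType) (d : nat) (u v : 'rV[R]_d) : dotp u v = dotp v u.
Proof. by apply: eq_bigr => i _; rewrite mulrC. Qed.

Lemma dotpDl (R : realType) (d : nat) (u v w : 'rV[R]_d) :
  dotp (u + v) w = dotp u w + dotp v w.
Proof. by rewrite !dotpE mulmxDl mxE. Qed.

Lemma dotpZl (R : realType) (d : nat) (t : R) (u v : 'rV[R]_d) :
  dotp (t *: u) v = t * dotp u v.
Proof. by rewrite !dotpE -scalemxAl mxE. Qed.

Lemma dotp0l (R : realType) (d : nat) (v : 'rV[R]_d) : dotp 0 v = 0.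
Proof. by rewrite dotpE mul0mx mxE. Qed.

Lemma dotpNl (R : realType) (d : nat) (u v : 'rV[R]_d) :
  dotp (- u) v = - dotp u v.
Proof. by rewrite -scaleN1r dotpZl mulN1r. Qed.

Lemma dotpDr (R : realType) (d : nat) (u v w : 'rV[R]_d) :
  dotp w (u + v) = dotp w u + dotp w v.
Proof. by rewrite dotpC dotpDl !(dotpC w). Qed.

Lemma dotpZr (R : realType) (d : nat) (t : R) (u v : 'rV[R]_d) :
  dotp u (t *: v) = t * dotp u v.
Proof. by rewrite dotpC dotpZl (dotpC u). Qed.

Lemma dotpNr (R : realType) (d : nat) (u v : 'rV[R]_d) :
  dotp u (- v) = - dotp u v.
Proof. by rewrite dotpC dotpNl (dotpC u). Qed.

Definition dotp_linE := (dotpDl, dotpDr, dotpNl, dotpNr, dotpZl, dotpZr).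

Lemma dotp_suml (R : realType) (d : nat) (I : finType) (F : I -> 'rV[R]_d) v :
  dotp (\sum_i F i) v = \sum_i dotp (F i) v.
Proof.
rewrite dotpE mulmx_suml summxE.
by apply: eq_bigr => i _; rewrite dotpE.
Qed.

Lemma dotp_ge0 (R : realType) (d : nat) (u : 'rV[R]_d) : 0 <= dotp u u.
Proof. by apply: sumr_ge0 => i _; rewrite -expr2 sqr_ge0. Qed.

Lemma sqr_enorm (R : realType) (d : nat) (u : 'rV[R]_d) :
  enorm u ^+ 2 = dotp u u.
Proof. by rewrite sqr_sqrtr ?dotp_ge0. Qed.

Lemma enorm_ge0 (R : realType) (d : nat) (u : 'rV[R]_d) : 0 <= enorm u.
Proof. exact: sqrtr_ge0. Qed.

Lemma enormN (R : realType) (d : nat) (u : 'rV[R]_d) : enorm (- u) = enorm u.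
Proof. by rewrite /enorm dotpNl dotpNr opprK. Qed.

(** One-sided Cauchy-Schwarz: expand the square of [D *: u + enorm u *: v] and divide by
    [2 * D * enorm u], which is why [enorm u = 0] is treated apart. *)
Lemma dotp_ge_ball (R : realType) (d : nat) (D : R) (u v : 'rV[R]_d) :
  0 < D -> enorm v <= D -> - (enorm u * D) <= dotp u v.
Proof.
move=> D0 vD.
have v2 : dotp v v <= D ^+ 2.
  by rewrite -sqr_enorm lerXn2r // nnegrE ?enorm_ge0 // ltW.
have u2 := sqr_enorm u.
have [n0|n0] := eqVneq (enorm u) 0.
  have u0 : u = 0.
    apply/rowP => i; rewrite mxE; apply/eqP.
    have : dotp u u == 0 by rewrite -u2 n0 expr0n.
    rewrite psumr_eq0 => [/allP /(_ i)|j _]; last by rewrite -expr2 sqr_ge0.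
    by rewrite mem_index_enum mulf_eq0 orbb /=; apply.
  by rewrite n0 mul0r oppr0 u0 dotp0l.
have npos : 0 < enorm u by rewrite lt_def n0 enorm_ge0.
have := dotp_ge0 (D *: u + enorm u *: v).
rewrite !dotp_linE (dotpC v u) -u2 => h.
have {}h : 0 <= (2 * D * enorm u) * (enorm u * D + dotp u v).
  have : 0 <= enorm u ^+ 2 * (D ^+ 2 - dotp v v).
    by rewrite mulr_ge0 ?sqr_ge0 ?subr_ge0.
  by move: h; lra.
move: h; rewrite pmulr_rge0 ?mulr_gt0 //; lra.
Qed.

(** * Gram forms and positive semidefinite matrices *)

Lemma gram_dotDl (R : realType) (n : nat) (A : 'M[R]_n) (u v w : 'rV[R]_n) :
  gram_dot A (u + v) w = gram_dot A u w + gram_dot A v w.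
Proof. by rewrite /gram_dot !mulmxDl mxE. Qed.

Lemma gram_dotZl (R : realType) (n : nat) (A : 'M[R]_n) t (u w : 'rV[R]_n) :
  gram_dot A (t *: u) w = t * gram_dot A u w.
Proof. by rewrite /gram_dot -!scalemxAl mxE. Qed.

Lemma gram_dotDr (R : realType) (n : nat) (A : 'M[R]_n) (u v w : 'rV[R]_n) :
  gram_dot A w (u + v) = gram_dot A w u + gram_dot A w v.
Proof. by rewrite /gram_dot linearD mulmxDr mxE. Qed.

Lemma gram_dotZr (R : realType) (n : nat) (A : 'M[R]_n) t (u w : 'rV[R]_n) :
  gram_dot A w (t *: u) = t * gram_dot A w u.
Proof. by rewrite /gram_dot linearZ -scalemxAr mxE. Qed.

Lemma gram_dotC (R : realType) (n : nat) (A : 'M[R]_n) (u v : 'rV[R]_n) :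
  A^T = A -> gram_dot A u v = gram_dot A v u.
Proof.
move=> sA; rewrite /gram_dot.
have -> : v *m A *m u^T = (u *m A *m v^T)^T by rewrite !trmx_mul trmxK sA mulmxA.
by rewrite [RHS]mxE.
Qed.

Lemma gram_dot_delta (R : realType) (n : nat) (A : 'M[R]_n) i j :
  gram_dot A (delta_mx 0 i) (delta_mx 0 j) = A i j.
Proof.
by rewrite /gram_dot trmx_delta -rowE -colE !mxE.
Qed.

Lemma gram_dot0 (R : realType) (n : nat) (u v : 'rV[R]_n) :
  gram_dot 0 u v = 0.
Proof. by rewrite /gram_dot mulmx0 mul0mx mxE. Qed.

Lemma gram_dotMtr (R : realType) (n d : nat) (P : 'M[R]_(n, d)) u v :
  gram_dot (P *m P^T) u v = dotp (u *m P) (v *m P).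
Proof. by rewrite dotpE /gram_dot trmx_mul !mulmxA. Qed.

Lemma psd_gram (R : realType) (n d : nat) (P : 'M[R]_(n, d)) : psd (P *m P^T).
Proof.
split=> [|u]; first by rewrite trmx_mul trmxK.
by have := dotp_ge0 (u *m P); rewrite -gram_dotMtr.
Qed.

Lemma psd_diag_ge0 (R : realType) (n : nat) (A : 'M[R]_n) i :
  psd A -> 0 <= A i i.
Proof. by case=> _ /(_ (delta_mx 0 i)); rewrite -/(gram_dot _ _ _) gram_dot_delta. Qed.

(** With a zero diagonal, the form at e_i + t e_j is 2 t A_ij; it is nonnegative for both signs of
    t. *)
Lemma psd_diag0 (R : realType) (n : nat) (A : 'M[R]_n) :
  psd A -> (forall i, A i i = 0) -> A = 0.
Proof.
move=> [sA pA] A0; apply/matrixP => i j; rewrite [RHS]mxE.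
have h (t : R) : 0 <= 2 * t * A i j.
  have := pA (delta_mx 0 i + t *: delta_mx 0 j).
  rewrite -/(gram_dot _ _ _) !(gram_dotDl, gram_dotDr, gram_dotZl, gram_dotZr).
  rewrite (@gram_dotC _ _ A (delta_mx 0 j) (delta_mx 0 i)) // !gram_dot_delta !A0.
  by move=> h; lra.
have := h 1; have := h (-1); lra.
Qed.

(** With c = <u, A e_i>, the form of the complement at u equals the form of A at u - (c / A_ii)
    e_i. *)
Lemma psd_schur (R : realType) (n : nat) (A : 'M[R]_n) i : psd A -> A i i != 0 ->
  psd (A - (A i i)^-1 *: ((row i A)^T *m row i A)).
Proof.
move=> [sA pA] Ai0; split.
  by rewrite linearB linearZ /= trmx_mul trmxK sA.
move=> u; set c := gram_dot A u (delta_mx 0 i).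
have := pA (u + (- (c / A i i)) *: delta_mx 0 i).
rewrite -!/(gram_dot _ _ _) !(gram_dotDl, gram_dotDr, gram_dotZl, gram_dotZr).
rewrite (@gram_dotC _ _ A (delta_mx 0 i) u) // -/c gram_dot_delta.
have -> : gram_dot (A - (A i i)^-1 *: ((row i A)^T *m row i A)) u u =
  gram_dot A u u - (A i i)^-1 * c ^+ 2.
  have cE : u *m (row i A)^T = c%:M.
    by rewrite [LHS]mx11_scalar rowE trmx_mul sA mulmxA.
  have cE' : row i A *m u^T = c%:M.
    by apply: trmx_inj; rewrite trmx_mul trmxK cE tr_scalar_mx.
  rewrite {1}/gram_dot mulmxBr mulmxBl -scalemxAr -scalemxAl mulmxA cE.
  rewrite -(mulmxA _ (row i A)) cE' -scalar_mxM mxE; congr (_ + _).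
  by rewrite !mxE mulr1n expr2.
by move=> /le_trans; apply; rewrite le_eqVlt; apply/orP; left; apply/eqP; field.
Qed.

(* Each Schur complement step splits off a positive rank one term and
   annihilates one more diagonal entry. *)
Lemma psd_tr_ge0 (R : realType) (n : nat) (Z A : 'M[R]_n) :
  psd Z -> psd A -> 0 <= \tr (Z^T *m A).
Proof.
move=> psdZ; have [m] := ubnP #|[pred i | A i i != 0]|.
elim: m A => // m IH A; rewrite ltnS => cA psdA.
have [/forallP A0|/forallPn [i Ai0]] := boolP [forall i, A i i == 0].
  by rewrite (psd_diag0 psdA) ?mulmx0 ?mxtrace0 // => i; apply/eqP.
set S := A - (A i i)^-1 *: ((row i A)^T *m row i A).
have psdS : psd S by exact: psd_schur.
have SE j : S j j = A j j - (A i i)^-1 * A i j ^+ 2.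
  by rewrite !mxE big_ord1 !mxE expr2.
have Ai_gt0 : 0 < A i i by rewrite lt_def Ai0 psd_diag_ge0.
have -> : A = S + (A i i)^-1 *: ((row i A)^T *m row i A) by rewrite subrK.
rewrite mulmxDr mxtraceD -scalemxAr mxtraceZ mulmxA.
apply: addr_ge0; last first.
  apply: mulr_ge0; first by rewrite invr_ge0 ltW.
  (* By cyclicity the trace against the rank one term is the form of [Z] at [row i A]. *)
  rewrite mxtrace_mulC trace_mx11 mulmxA; have [sZ pZ] := psdZ.
  by rewrite sZ; exact: pZ.
apply: IH => //; apply: leq_trans cA; apply: proper_card; apply/properP; split.
  (* A zero diagonal entry stays zero: S_jj = - A_ij^2 / A_ii is nonpositive, and nonnegative
     because [S] is psd. *)
  apply/fintype.subsetP => j; rewrite !inE; apply: contraNN => /eqP Aj0.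
  have := psd_diag_ge0 j psdS; rewrite SE Aj0 sub0r oppr_ge0 => h.
  rewrite oppr_eq0 eq_le h mulr_ge0 ?sqr_ge0 // invr_ge0; exact: ltW.
by exists i; rewrite !inE // SE negbK expr2 mulrA mulVf // mul1r subrr.
Qed.

(** * Consequences of the dual identity for the multipliers *)

Lemma complementary_slackness (R : realType) (N : nat) (M D : R) (W : 'M[R]_N)
    r lam gam sigma Z F G :
  dual_feasible M D W r lam gam sigma Z -> pep_feasible M D W F G ->
  pep_obj F = r -> forall i j, lam i j * pep_C W F G i j = 0.
Proof.
move=> [lam0 gam0 sig0 psdZ id_dual] [C0 M0 D0 psdG] objF.
have := id_dual F G (proj1 psdG); rewrite objF subrr.
have row_ge0 i : 0 <= \sum_(j : option 'I_N.+1) lam i j * pep_C W F G i j.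
  by apply: sumr_ge0 => j _; rewrite mulr_ge0.
have gM0 : 0 <= \sum_(i : option 'I_N.+1) gam i * pep_M M G i.
  by apply: sumr_ge0 => i _; rewrite mulr_ge0.
have sD0 : 0 <= sigma * pep_D D G by rewrite mulr_ge0.
have ZG0 := psd_tr_ge0 psdZ psdG.
have := sumr_ge0 (index_enum (option 'I_N.+1)) (fun i (_ : true) => row_ge0 i).
set S := \sum_(i : option 'I_N.+1) _; move=> S_ge0 sum0.
have S0 : S = 0 by lra.
move=> i j; have row0 := psumr_eq0P (fun i (_ : true) => row_ge0 i) S0 (erefl : true) (i := i).
exact: (psumr_eq0P (fun j (_ : true) => mulr_ge0 (lam0 i j) (C0 i j)) row0).
Qed.

(** Subtracting the identity at F = 0 from the one at the indicator of the star, both with G = 0,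
    cancels [r] and the terms in [gam], [sigma] and [Z], leaving only the coefficient of f_star. *)
Lemma dual_weights_sum1 (R : realType) (N : nat) (M D : R) (W : 'M[R]_N)
    r lam gam sigma Z :
  dual_feasible M D W r lam gam sigma Z ->
  (forall k, lam (Some k) None = 0) ->
  \sum_(k < N.+1) lam None (Some k) = 1.
Proof.
move=> [_ _ _ _ id_dual] lam0.
have sym0 : (0 : 'M[R]_N.+2)^T = 0 by rewrite trmx0.
have := id_dual (fun i => (i == None)%:R) 0 sym0.
have := id_dual (fun=> 0) 0 sym0.
have -> : \sum_(i : option 'I_N.+1) \sum_(j : option 'I_N.+1)
   lam i j * pep_C W (fun=> 0) 0 i j = 0.
  by rewrite big1 // => i _; rewrite big1 // => j _;
    rewrite /pep_C gram_dot0 !subrr mulr0.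
have -> : \sum_(i : option 'I_N.+1) \sum_(j : option 'I_N.+1)
   lam i j * pep_C W (fun i => (i == None)%:R) 0 i j =
   \sum_(k < N.+1) lam None (Some k).
  rewrite sum_option [X in _ + X]big1 => [|k _]; last first.
    rewrite sum_option lam0 mul0r big1 ?addr0 // => l _.
    by rewrite /pep_C gram_dot0 !subrr mulr0.
  rewrite addr0 sum_option /pep_C gram_dot0 !subrr mulr0 add0r.
  by apply: eq_bigr => k _; rewrite gram_dot0 !subr0 mulr1.
rewrite /pep_obj /= subrr; lra.
Qed.

(** * The dual identity at concrete points *)

Section Points.
Variables (R : realType) (N d : nat) (W : 'M[R]_N).
Variables (x g : 'I_N.+1 -> 'rV[R]_d).
Hypothesis recx : forall n : 'I_N, x (lift ord0 n) =
  x ord0 - \sum_(i < N | (i <= n)%N) W n i *: g (widen_ord (leqnSn N) i).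

(** This is the transpose of P with x_star replaced by a free point [y]. Coordinate rows act from
    the left, so the Gram matrix is [P *m P^T]. *)
Definition pep_points (y : 'rV[R]_d) : 'M[R]_(N.+2, d) :=
  \matrix_(i < N.+2) (if unlift ord0 i is Some k then g k else x ord0 - y).

Lemma gcoord_points y k : gcoord R (Some k) *m pep_points y = g k.
Proof. by rewrite -rowE rowK liftK. Qed.

Lemma x0coord_points y : delta_mx 0 ord0 *m pep_points y = x ord0 - y.
Proof. by rewrite -rowE rowK unlift_none. Qed.

Lemma xcoord_points y k : xcoord W (Some k) *m pep_points y = x k - y.
Proof.
rewrite [xcoord _ _]/= mulmxBl x0coord_points.
case: unliftP => [n ->|->]; last by rewrite mul0mx subr0.
rewrite mulmx_suml recx -addrA [- y + _]addrC addrA; congr (_ - _ - _).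
by apply: eq_bigr => i _; rewrite -scalemxAl gcoord_points.
Qed.

(** No function is involved: [F] and [g] are arbitrary and [x] only obeys the recursion. The
    constraints C_(k,star) would force [y] to behave like a minimizer, but their multipliers
    vanish. *)
Lemma dual_bound_points (M D r : R) lam gam sigma Z
    (F : 'I_N.+1 -> R) (y : 'rV[R]_d) :
  dual_feasible M D W r lam gam sigma Z ->
  (forall k, lam (Some k) None = 0) ->
  F ord_max
  - \sum_k lam None (Some k) * (F k + dotp (g k) (y - x k))
  + \sum_k \sum_l lam (Some k) (Some l) * (F k - F l - dotp (g l) (x k - x l))
  + \sum_k gam (Some k) * (M ^+ 2 - dotp (g k) (g k))
  + sigma * (D ^+ 2 - dotp (x ord0 - y) (x ord0 - y)) <= r.
Proof.
move=> dual lam0; have [_ gam0 _ psdZ id_dual] := dual.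
pose P := pep_points y; pose G := P *m P^T.
(* The value 0 at the star loses nothing, since f_star has the same coefficient on both sides of the
   identity. *)
pose FF (i : pep_index N) := if i is Some k then F k else 0.
have psdG : psd G by exact: psd_gram.
have gdE u v : gram_dot G u v = dotp (u *m P) (v *m P) by exact: gram_dotMtr.
have CSS k l : pep_C W FF G (Some k) (Some l) =
    F k - F l - dotp (g l) (x k - x l).
  rewrite /pep_C gdE mulmxBl gcoord_points !xcoord_points.
  by rewrite opprB addrA subrK.
have CNS k : pep_C W FF G None (Some k) = - (F k + dotp (g k) (y - x k)).
  rewrite /pep_C gdE mulmxBl mul0mx gcoord_points xcoord_points.
  by rewrite !sub0r opprB opprD.
have CNN : pep_C W FF G None None = 0.
  by rewrite /pep_C !subrr gdE !mul0mx dotp0l subrr.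
have starE : \sum_(j : option 'I_N.+1) lam None j * pep_C W FF G None j =
    - \sum_k lam None (Some k) * (F k + dotp (g k) (y - x k)).
  rewrite sum_option CNN mulr0 add0r -sumrN.
  by apply: eq_bigr => k _; rewrite CNS mulrN.
have restE k : \sum_(j : option 'I_N.+1) lam (Some k) j * pep_C W FF G (Some k) j =
    \sum_l lam (Some k) (Some l) * (F k - F l - dotp (g l) (x k - x l)).
  rewrite sum_option lam0 mul0r add0r.
  by apply: eq_bigr => l _; rewrite CSS.
have gamE : \sum_(i : option 'I_N.+1) gam i * pep_M M G i =
    gam None * M ^+ 2 + \sum_k gam (Some k) * (M ^+ 2 - dotp (g k) (g k)).
  rewrite sum_option /pep_M gdE !mul0mx dotp0l subr0; congr (_ + _).
  by apply: eq_bigr => k _; rewrite gdE gcoord_points.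
have := id_dual FF G (proj1 psdG).
rewrite sum_option starE (eq_bigr _ (fun k _ => restE k)) gamE.
rewrite /pep_D gdE x0coord_points /pep_obj [FF None]/= [FF (Some _)]/=.
(* Only <Z, G> and the star term [gam None * M ^+ 2] are dropped. *)
have := psd_tr_ge0 psdZ psdG.
have := mulr_ge0 (gam0 None) (sqr_ge0 M).
lra.
Qed.

End Points.

(** If sigma were 0, the bound at points of the line would be affine in [y] with slope -1, hence
    unbounded above. The signs of the other terms do not matter, as they are constant in [y]; in
    particular [M] may be below 1. *)
Lemma dual_sigma_gt0 (R : realType) (N : nat) (M D : R) (W : 'M[R]_N)
    r lam gam sigma Z :
  dual_feasible M D W r lam gam sigma Z ->
  (forall k, lam (Some k) None = 0) -> 0 < sigma.
Proof.
move=> dual lam0; have [_ _ sig0 _ _] := dual.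
rewrite lt_def sig0 andbT; apply/eqP => s0.
pose g := fun _ : 'I_N.+1 => const_mx 1 : 'rV[R]_1.
(* The recursion started at x_0 = 0. *)
pose x (k : 'I_N.+1) : 'rV[R]_1 := - (if unlift ord0 k is Some n then
  \sum_(i < N | (i <= n)%N) W n i *: g (widen_ord (leqnSn N) i) else 0).
have recx n : x (lift ord0 n) =
    x ord0 - \sum_(i < N | (i <= n)%N) W n i *: g (widen_ord (leqnSn N) i).
  by rewrite /x liftK unlift_none oppr0 sub0r.
have bound t := dual_bound_points recx (fun=> 0) (const_mx t) dual lam0.
set c := \sum_k \sum_l lam (Some k) (Some l) *
  (0 - 0 - dotp (g l) (x k - x l))
  + \sum_k gam (Some k) * (M ^+ 2 - dotp (g k) (g k))
  + \sum_k lam None (Some k) * dotp (g k) (x k).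
have {}bound t : - t + c <= r.
  apply: le_trans (bound t); rewrite s0 mul0r addr0 sub0r.
  have -> : \sum_k lam None (Some k) * (0 + dotp (g k) (const_mx t - x k)) =
    t - \sum_k lam None (Some k) * dotp (g k) (x k).
    (* The weights sum to 1, so the coefficient of [t] is exactly 1. *)
    rewrite -[X in X - _]mul1r -(dual_weights_sum1 dual lam0) mulr_suml -sumrB.
    apply: eq_bigr => k _; rewrite add0r dotpDr dotpNr mulrBr; congr (_ * _ - _).
    by rewrite /dotp big_ord1 !mxE mul1r.
  rewrite /c; lra.
(* This choice of [t] turns the bound into r + 1 <= r. *)
have := bound (c - r - 1); lra.
Qed.

(** * Gradients, subgradients and minima of affine functions on balls *)

Lemma grad_affine (R : realType) (d : nat) (h : 'rV[R]_d -> R) v c x :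
  (forall y, h y = dotp v y + c) -> grad h x = v.
Proof.
move=> hE; apply/rowP => j; rewrite mxE /derive.
(* The difference quotient is constant for t != 0, so any radius would do. *)
apply: lim_near_cst => //; apply/nbhs_ballP; exists 1 => //= t _ t0.
rewrite /= /shift /= !hE dotpDr dotpZr.
rewrite (_ : _ - _ = t * dotp v (delta_mx 0 j)); last by ring.
by rewrite [LHS]mulrA mulVf // mul1r dotpE trmx_delta -colE mxE.
Qed.

(** Testing the subgradient inequality at x + g gives |g|^2 <= f(x + g) - f(x) <= M |g|. *)
Lemma subgradient_norm_le (R : realType) (d : nat) (M : R) (f : 'rV[R]_d -> R)
    (x g : 'rV[R]_d) :
  lipschitz_euclid M f -> subdifferential f x g -> dotp g g <= M ^+ 2.
Proof.
move=> lip /(_ (x + g)); have /ler_normlW := lip (x + g) x.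
rewrite [x + g]addrC addrK -sqr_enorm; have n0 := enorm_ge0 g => h1 h2.
have {h1 h2} h : enorm g * enorm g <= M * enorm g by rewrite -expr2; lra.
have [->|n_neq0] := eqVneq (enorm g) 0; first by rewrite expr0n sqr_ge0.
have npos : 0 < enorm g by rewrite lt_def n_neq0.
by rewrite lerXn2r ?nnegrE //; rewrite ler_pM2r // in h; apply: le_trans h.
Qed.

Lemma affine_min_on_ball (R : realType) (d : nat) (h : 'rV[R]_d -> R) v c
    (D : R) (x0 : 'rV[R]_d) :
  0 < D -> (forall y, h y = dotp v y + c) ->
  is_min_on [set y | enorm (y - x0) <= D] h (h x0 - enorm v * D).
Proof.
move=> D0 hE; split=> [|y /= yD]; last first.
  have := dotp_ge_ball v D0 yD; rewrite !hE !dotp_linE; lra.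
(* When [v = 0] the division by [enorm v = 0] gives [0], so that [y = x0]. *)
exists (x0 - (D / enorm v) *: v) => /=; last first.
  rewrite !hE !dotp_linE -sqr_enorm.
  have [->|n0] := eqVneq (enorm v) 0; first by ring.
  by field.
rewrite [x0 - _]addrC addrK enormN {1}/enorm dotpZl dotpZr -sqr_enorm.
rewrite mulrA -expr2 -exprMn sqrtr_sqr.
have [->|n0] := eqVneq (enorm v) 0; first by rewrite mulr0 normr0 ltW.
by rewrite divfK // ger0_norm // ltW.
Qed.

(** * The dual certificate and the bounds *)

Lemma nondegenerate_dual_certificate (R : realType) (N : nat) (M D : R)
    (W : 'M[R]_N) :
  nondegenerate_method M D W ->
  exists r lam gam sigma Z, [/\ pep_value M D W = r%:E,
    dual_feasible M D W r lam gam sigma Z &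
    forall k, lam (Some k) None = 0].
Proof.
move=> [strong _ [r [[r' [lam [gam [sigma [Z dual]]]]] /= r'E rmin]] nondeg].
rewrite r'E in dual; exists r, lam, gam, sigma, Z.
have dualE : dual_value M D W = r%:E.
  apply/eqP; rewrite eq_le; apply/andP; split.
    by apply: ereal_inf_lbound; exists r => //; exists lam, gam, sigma, Z.
  by apply: le_ereal_inf_tmp => _ [s sdual <-]; rewrite lee_fin; exact: rmin.
have pepE : pep_value M D W = r%:E by rewrite strong.
(* The primal optimum may change with [k]; the dual optimum is fixed, and slackness holds between it
   and each of them. *)
split=> // k; have [F [G [[feas opt] Fk]]] := nondeg k.
have objF : pep_obj F = r.
  apply: EFin_inj; rewrite -pepE; apply/eqP; rewrite eq_le; apply/andP; split.
    by apply: ereal_sup_ubound; exists F, G.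
  by apply: ge_ereal_sup => _ [F' [G' [feas' ->]]]; rewrite lee_fin; exact: opt feas'.
have := complementary_slackness dual feas objF (Some k) None.
(* Since g_star = 0, C_(k,star) reduces to f_k - f_star, which is positive here. *)
rewrite /pep_C /gram_dot !mul0mx mxE subr0 => /eqP.
by rewrite mulf_eq0 subr_eq0 (gt_eqF Fk) orbF => /eqP.
Qed.

Theorem theorem5p1 (R : realType) (N : nat) (M D : R) (W : 'M[R]_N)
    (hN : (1 <= N)%N) (hM : 0 < M) (hD : 0 < D)
    (hW : is_trig_mx W) (hnd : nondegenerate_method M D W) :
  exists (a : 'rV[R]_N.+1) (sigma : R),
    [/\ forall i, 0 <= a 0 i,
        \sum_(i < N.+1) a 0 i = 1,
        0 < sigma
      & forall (d : nat) (f : 'rV[R]_d -> R) (xs : 'rV[R]_d)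
          (x g : 'I_N.+1 -> 'rV[R]_d),
        (1 <= d)%N ->
        lipschitz_euclid M f ->
        convex_function [set: convex_lmodType 'rV[R]_d] f ->
        minimizer f xs ->
        enorm (x ord0 - xs) <= D ->
        (forall n : 'I_N,
           x (lift ord0 n) =
           x ord0 - \sum_(i < N | (i <= n)%N)
                       W n i *: g (widen_ord (leqnSn N) i)) ->
        (forall i, subdifferential f (x i) (g i)) ->
        let fN := f (x ord_max) in
        let fs := f xs in
        let alpha := fun y : 'rV[R]_d =>
          \sum_(i < N.+1) a 0 i * (f (x i) + dotp (g i) (y - x i)) in
        let z := x ord0 - (2 * sigma)^-1 *: grad alpha (x ord0) in
        [/\ affine_minorants f alpha,
            affine_minorants f `<=` affine_minorants_at f xs,
            fN - fs <= fN - alpha xs + sigma * enorm (z - xs) ^+ 2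
            /\ ((fN - alpha xs + sigma * enorm (z - xs) ^+ 2)%:E
                  <= pep_value M D W)%E
          & exists m : R,
              [/\ is_min_on [set y | enorm (y - x ord0) <= D] alpha m,
                  fN - fs <= fN - m
                & ((fN - m)%:E <= pep_value M D W)%E]]].
Proof.
have [r [lam [gam [sigma [Z [pepE dual lam0]]]]]] :=
  nondegenerate_dual_certificate hnd.
have [lam_ge0 gam_ge0 _ _ _] := dual.
have sum_a := dual_weights_sum1 dual lam0.
have sig_gt0 := dual_sigma_gt0 dual lam0.
(* Both witnesses come from the dual optimum alone, hence are uniform in the dimension, the function
   and the points. *)
exists (\row_k lam None (Some k)), sigma; split=> //.
- by move=> i; rewrite mxE.
- by under eq_bigr do rewrite mxE.
move=> d f xs x g _ lip _ mini x0D recx subg fN fs alpha z.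
pose a k := lam None (Some k); pose v := \sum_k a k *: g k.
pose c := \sum_k a k * (f (x k) - dotp (g k) (x k)).
have alphaE0 y : alpha y = \sum_k a k * (f (x k) + dotp (g k) (y - x k)).
  by apply: eq_bigr => k _; rewrite mxE.
have alphaE y : alpha y = dotp v y + c.
  rewrite alphaE0 dotp_suml -big_split; apply: eq_bigr => k _ /=.
  by rewrite dotpZl dotpDr dotpNr -mulrDr addrCA.
have alpha_le y : alpha y <= f y.
  rewrite alphaE0 -[leRHS]mul1r -sum_a mulr_suml; apply: ler_sum => k _.
  by rewrite ler_wpM2l ?lam_ge0 //; exact: subg.
(* The remaining slack terms are nonnegative by the subgradient inequalities and the Lipschitz
   bound; [y] stays free. *)
have key y : fN - alpha y + sigma * (D ^+ 2 - dotp (x ord0 - y) (x ord0 - y)) <= r.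
  have := dual_bound_points recx (f \o x) y dual lam0.
  rewrite -alphaE0.
  have : 0 <= \sum_k \sum_l lam (Some k) (Some l) *
      (f (x k) - f (x l) - dotp (g l) (x k - x l)).
    apply: sumr_ge0 => k _; apply: sumr_ge0 => l _; apply: mulr_ge0 => //.
    by have := subg l (x k); lra.
  have : 0 <= \sum_k gam (Some k) * (M ^+ 2 - dotp (g k) (g k)).
    apply: sumr_ge0 => k _; apply: mulr_ge0 => //.
    by rewrite subr_ge0; exact: subgradient_norm_le lip (subg k).
  rewrite /fN /=; lra.
have zE : z = x ord0 - (2 * sigma)^-1 *: v by rewrite /z (grad_affine _ alphaE).
have x0D2 : dotp (x ord0 - xs) (x ord0 - xs) <= D ^+ 2.
  by rewrite -sqr_enorm lerXn2r // nnegrE ?enorm_ge0 // ltW.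
split.
- by split=> //; exists v, c.
- by move=> h [aff h_le]; split.
- split.
    have := mulr_ge0 (ltW sig_gt0) (sqr_ge0 (enorm (z - xs))).
    by have := alpha_le xs; rewrite /fN /fs; lra.
  rewrite pepE lee_fin; apply: le_trans (key z).
  (* Completing the square: [z] minimizes
     [y |-> alpha y + sigma * enorm (x0 - y) ^+ 2]. *)
  have -> : fN - alpha xs + sigma * enorm (z - xs) ^+ 2 =
      fN - alpha z - sigma * dotp (x ord0 - z) (x ord0 - z)
      + sigma * dotp (x ord0 - xs) (x ord0 - xs).
    rewrite sqr_enorm zE !alphaE !dotp_linE (dotpC xs) (dotpC v (x ord0)) (dotpC v xs).
    by field; rewrite gt_eqF.
  by have := ler_wpM2l (ltW sig_gt0) x0D2; lra.
have minE := affine_min_on_ball (x ord0) hD alphaE.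
exists (alpha (x ord0) - enorm v * D); split=> //.
  (* The ball contains [xs], so the minimum is at most alpha(x_star) <= f_star. *)
  have [_ /(_ xs)] := minE; rewrite /= -enormN opprB => /(_ x0D).
  by have := alpha_le xs; rewrite /fN /fs; lra.
have [[y /= yD <-] _] := minE.
rewrite pepE lee_fin; apply: le_trans (key y).
(* At a minimizer [y] in the ball, the sigma term of [key] is nonnegative and can be discarded. *)
rewrite lerDl mulr_ge0 ?(ltW sig_gt0) // subr_ge0 -sqr_enorm.
by rewrite lerXn2r ?nnegrE ?enorm_ge0 ?(ltW hD) // -enormN opprB.
Qed.
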